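(* Let $G$ be a Hausdorff topological group and let $(X,\theta)$ be a $G$-space with enveloping space $X_G$. If $X$ is $G$-contractible, then $X_G$ (with its enveloping action) is $G$-contractible.
   Context: Partial actions. A partial action of a group $G$ (identity $e$) on a set $X$ is a map $\theta:G*X\to X$, $(g,x)\mapsto g\cdot x$, defined on a subset $G*X\subseteq G\times X$ (write $\exists\, g\cdot x$ for $(g,x)\in G*X$), such that for all $g,h\in G$, $x\in X$: (PA1) if $\exists\, g\cdot x$ then $\exists\, g^{-1}\cdot(g\cdot x)$ and $g^{-1}\cdot(g\cdot x)=x$; (PA2) if $\exists\, g\cdot(h\cdot x)$ then $\exists\,(gh)\cdot x$ and $g\cdot(h\cdot x)=(gh)\cdot x$; (PA3) $\exists\, e\cdot x$ and $e\cdot x=x$. Put $X_g=\{x\in X:\exists\, g^{-1}\cdot x\}$, $\theta_g:X_{g^{-1}}\to X_g$, $x\mapsto g\cdot x$, and $G^x=\{g\in G:(g,x)\in G*X\}$. If $G$ is a topological group and $X$ a topological space, $\theta$ is topological if every $X_g$ is open in $X$ and every $\theta_g$ is a homeomorphism, and continuous if $\theta$ is continuous for the subspace topology on $G*X\subseteq G\times X$. All topological groups are Hausdorff and all partial actions are topological. A $G$-space is a pair $(X,\theta)$ with $\theta$ a continuous (topological) partial action of $G$ on the topological space $X$. A $G$-map $f:(X,\theta)\to(Y,\eta)$ is a continuous map such that for all $(g,x)\in G*X$ one has $(g,f(x))\in G*Y$ and $\eta(g,f(x))=f(\theta(g,x))$. Enveloping space. $X_G=(G\times X)/R$ with the quotient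 topology, where $(g,x)R(h,y)$ iff $x\in X_{g^{-1}h}$ and $\theta_{h^{-1}g}(x)=y$; the class of $(g,x)$ is $[g,x]$. The enveloping action of $G$ on $X_G$ is the continuous global action $\mu(g,[h,x])=[gh,x]$. $G$-contractibility. The isotropy group of $x$ is $G_x=\{g\in G^x:\theta(g,x)=x\}$; $w\in X$ is a fixed point if $G_w=G$. With $I=[0,1]$ carrying the trivial global action, $X\times I$ is a $G$-space via the diagonal partial action: $(g,(x,t))\in G*(X\times I)$ iff $(g,x)\in G*X$, and then $g\cdot(x,t)=(g\cdot x,t)$. $X$ is $G$-contractible if there is a $G$-map $H:X\times I\to X$ with $H(\cdot,1)=\mathrm{id}_X$ and $H(x,0)=w$ for all $x\in X$, for some fixed point $w\in X$. *)

(* Defs.v *)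
From HB Require Import structures.
From mathcomp Require Import all_boot all_order all_algebra.
From mathcomp Require Import all_classical all_reals all_analysis.
Set Implicit Arguments.
Unset Strict Implicit.
Unset Printing Implicit Defensive.

Import Order.TTheory GRing.Theory Num.Theory.
Import numFieldTopology.Exports.

Local Open Scope classical_set_scope.
Local Open Scope quotient_scope.
Local Open Scope group_scope.

HB.structure Definition PreTopologicalGroup := {G of Topological G & Group G}.

HB.mixin Record PreTopologicalGroup_isTopologicalGroup G
    of PreTopologicalGroup G := {
  mulg_continuous : continuous (fun p : G * G => p.1 * p.2);
  invg_continuous : continuous (fun x : G => x^-1)
}.

#[short(type="topologicalGroupType")]
HB.structure Definition TopologicalGroup :=
  {G of PreTopologicalGroup G & PreTopologicalGroup_isTopologicalGroup G}.

(* The partial map is encoded by its domain [pa_dom] and a total function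
   [pa_act]; the values of [pa_act] outside [pa_dom] are irrelevant. *)
Record partialAction (G : groupType) (X : Type) := PartialAction {
  pa_dom : set (G * X);
  pa_act : G -> X -> X;
  partial_actK : forall g x, pa_dom (g, x) ->
    pa_dom (g^-1, pa_act g x) /\ pa_act g^-1 (pa_act g x) = x;
  partial_actM : forall g h x, pa_dom (h, x) -> pa_dom (g, pa_act h x) ->
    pa_dom (g * h, x) /\ pa_act g (pa_act h x) = pa_act (g * h) x;
  partial_act1 : forall x, pa_dom (1, x) /\ pa_act 1 x = x
}.

Definition pa_set (G : groupType) (X : Type) (th : partialAction G X) (g : G)
  : set X := [set x | pa_dom th (g^-1, x)].

(* [f] restricts to a homeomorphism from [A] onto [B]; [f'] agrees with the
   inverse bijection on [B], since [f] maps [A] onto [B]. *)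
Definition homeomorphism_on (T : topologicalType) (A B : set T) (f : T -> T) :=
  [/\ set_bij A B f, {within A, continuous f} &
      exists2 f' : T -> T, {in A, cancel f f'} & {within B, continuous f'}].

Definition topological_pa (G : topologicalGroupType) (X : topologicalType)
    (th : partialAction G X) :=
  forall g, open (pa_set th g) /\
    homeomorphism_on (pa_set th g^-1) (pa_set th g) (pa_act th g).

Definition continuous_pa (G : topologicalGroupType) (X : topologicalType)
    (th : partialAction G X) :=
  {within pa_dom th, continuous (fun p : G * X => pa_act th p.1 p.2)}.

Record gspace (G : topologicalGroupType) := GSpace {
  gs_carrier :> topologicalType;
  gs_act : partialAction G gs_carrier;
  gs_topological : topological_pa gs_act;
  gs_continuous : continuous_pa gs_act
}.

Definition gmap (G : topologicalGroupType) (X Y : gspace G) (f : X -> Y) :=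
  continuous f /\
  forall g x, pa_dom (gs_act X) (g, x) ->
    pa_dom (gs_act Y) (g, f x) /\
    pa_act (gs_act Y) g (f x) = f (pa_act (gs_act X) g x).

Definition isotropy (G : groupType) (X : Type) (th : partialAction G X) (x : X)
  : set G := [set g | pa_dom th (g, x) /\ pa_act th g x = x].

Definition fixed_point (G : groupType) (X : Type) (th : partialAction G X)
  (w : X) := isotropy th w = setT.

Section enveloping.
Context {G : topologicalGroupType} (X : gspace G).
Local Notation th := (gs_act X).

Definition env_relP (p q : G * X) : Prop :=
  pa_set th (p.1^-1 * q.1) p.2 /\ pa_act th (q.1^-1 * p.1) p.2 = q.2.

Let env_rel (p q : G * X) := `[< env_relP p q >].

Let env_relE p q : env_relP p q <->
  pa_dom th (q.1^-1 * p.1, p.2) /\ pa_act th (q.1^-1 * p.1) p.2 = q.2.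
Proof. by rewrite /env_relP /pa_set /= invgM invgK. Qed.

Let env_rel_refl : reflexive env_rel.
Proof. by move=> p; apply/asboolP/env_relE; rewrite mulVg; exact: partial_act1. Qed.

Let env_relP_sym p q : env_relP p q -> env_relP q p.
Proof.
move=> /env_relE[d e]; apply/env_relE.
by have := partial_actK d; rewrite invgM invgK e.
Qed.

Let env_rel_sym : symmetric env_rel.
Proof. by move=> p q; apply/asboolP/asboolP; exact: env_relP_sym. Qed.

Let env_rel_trans : transitive env_rel.
Proof.
move=> q p r /asboolP/env_relE[d e] /asboolP/env_relE[d' e'].
apply/asboolP/env_relE; rewrite -e in d' e'.
have := partial_actM d d'.
by rewrite e' -mulgA (mulgA q.1) mulgV mul1g => -[? <-].
Qed.

Definition env_equiv := EquivRel env_rel env_rel_refl env_rel_sym env_rel_trans.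

Definition enveloping : Type := {eq_quot env_equiv}.

HB.instance Definition _ := Topological.copy enveloping
  (quotient_topology {eq_quot env_equiv}).
HB.instance Definition _ := Quotient.on enveloping.

Definition env_class (g : G) (x : X) : enveloping := \pi_enveloping (g, x).

Lemma env_classE g x h y :
  env_class g x = env_class h y <-> env_relP (g, x) (h, y).
Proof.
split; first by move/eqmodP => /asboolP.
by move=> H; apply/eqmodP/asboolP.
Qed.

Definition env_act (g : G) (p : enveloping) : enveloping :=
  env_class (g * (repr p).1) (repr p).2.

Lemma env_actE g h x : env_act g (env_class h x) = env_class (g * h) x.
Proof.
rewrite /env_act; set p := repr _.
have /env_classE : env_class p.1 p.2 = env_class h x.
  by rewrite /env_class -surjective_pairing /p reprK.
move=> /env_relE/= r; apply/env_classE/env_relE => /=.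
by rewrite invgM -mulgA (mulgA g^-1) mulVg mul1g.
Qed.

Lemma env_classP (P : enveloping -> Prop) :
  (forall g x, P (env_class g x)) -> forall p, P p.
Proof. by move=> H; apply: quotW => -[g x]; exact: H. Qed.

Fact env_actK g p : setT (g, p) -> setT (g^-1, env_act g p) /\
  env_act g^-1 (env_act g p) = p.
Proof.
move=> _; split=> //; elim/env_classP: p => h x.
by rewrite !env_actE mulgA mulVg mul1g.
Qed.

Fact env_actM g h p : setT (h, p) -> setT (g, env_act h p) ->
  setT (g * h, p) /\ env_act g (env_act h p) = env_act (g * h) p.
Proof.
move=> _ _; split=> //; elim/env_classP: p => k x.
by rewrite !env_actE mulgA.
Qed.

Fact env_act1 p : setT ((1 : G), p) /\ env_act 1 p = p.
Proof. by split=> //; elim/env_classP: p => h x; rewrite env_actE mul1g. Qed.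

Definition env_partialAction : partialAction G enveloping :=
  PartialAction env_actK env_actM env_act1.

Lemma env_class_continuous : continuous (fun p : G * X => env_class p.1 p.2).
Proof.
have -> : (fun p : G * X => env_class p.1 p.2) = \pi_enveloping.
  by apply/funext => -[].
exact: pi_continuous.
Qed.

Lemma gs_act_near k y : pa_dom th (k, y) ->
  (\forall z \near y, pa_dom th (k, z)) /\ {for y, continuous (pa_act th k)}.
Proof.
move=> d; have [ok] := gs_topological X k^-1.
have [_ [_ ck _]] := gs_topological X k.
move=> _; have dE z : pa_set th k^-1 z = pa_dom th (k, z).
  by rewrite /pa_set /= invgK.
split.
  have : nbhs y (pa_set th k^-1) by apply: open_nbhs_nbhs; split; rewrite ?dE.
  by apply: filterS => z; rewrite dE.
move: ck; rewrite continuous_open_subspace // => /(_ y); apply.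
by rewrite inE dE.
Qed.

(* Openness of the projection is what makes the enveloping action jointly
   continuous. *)
Lemma env_class_open (U : set (G * X)) : open U ->
  open [set env_class p.1 p.2 | p in U].
Proof.
move=> oU; rewrite /open /= /quotient_open; rewrite openE => -[h y] /=.
move=> [[g x] /= Ugx /esym/env_classE/env_relE/= []].
set k := g^-1 * h => d e; rewrite /interior /=.
have [nd ck] := gs_act_near d.
have hk : h * k^-1 = g by rewrite /k invgM invgK mulgA mulgV mul1g.
have ch : (fun a : G => a * k^-1) @ h --> g.
  rewrite -hk; apply: (@continuous_comp _ _ _ (fun a : G => (a, k^-1))
    (fun p : G * G => p.1 * p.2)); last exact: mulg_continuous.
  by apply: cvg_pair; [exact: cvg_id|exact: cvg_cst].
have cphi : (fun p : G * X => (p.1 * k^-1, pa_act th k p.2)) @ (h, y) --> (g, x).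
  apply: cvg_pair.
  - by apply: cvg_comp ch; exact: cvg_fst.
  - rewrite -e; apply: (cvg_comp _ (pa_act th k)) ck; exact: cvg_snd.
have := cphi U; rewrite nbhs_simpl => /(_ (open_nbhs_nbhs (conj oU Ugx))) nU.
have nd' : \forall p \near (h, y), pa_dom th (k, p.2) by exact: cvg_snd nd.
move: nU nd'; apply: (@filterS2 _ (nbhs (h, y))) => -[a b] /= Uab dkb.
exists (a * k^-1, pa_act th k b) => //=; apply/esym/env_classE/env_relE => /=.
by rewrite invgM invgK -mulgA mulVg mulg1.
Qed.

Lemma env_act_continuous : continuous (fun p : G * enveloping => env_act p.1 p.2).
Proof.
move=> [g q]; elim/env_classP: q => h x U /=.
rewrite env_actE nbhsE => -[V [oV Vgh] VU].
have : nbhs (g * h, x) [set p : G * X | V (env_class p.1 p.2)].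
  by apply: (env_class_continuous (x := (g * h, x))); exact: open_nbhs_nbhs.
have c : (fun p : G * (G * X) => (p.1 * p.2.1, p.2.2)) @ (g, (h, x)) -->
    (g * h, x).
  apply: cvg_pair => /=; last first.
    by apply: (@cvg_comp _ _ _ snd snd _ (nbhs (h, x))); [exact: cvg_snd|exact: cvg_snd].
  apply: (@cvg_comp _ _ _ (fun p : G * (G * X) => (p.1, p.2.1))
    (fun p : G * G => p.1 * p.2) _ (nbhs (g, h))); last exact: (mulg_continuous (g, h)).
  apply: cvg_pair => /=; first exact: cvg_fst.
  by apply: (@cvg_comp _ _ _ snd fst _ (nbhs (h, x))); [exact: cvg_snd|exact: cvg_fst].
move=> /c; rewrite nbhs_simpl => -[[A B] /= [nA nB] AB].
move: nB; rewrite nbhsE => -[B' [oB' B'hx] B'B].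
exists (A, [set env_class p.1 p.2 | p in B']) => /=.
  split=> //; apply: open_nbhs_nbhs; split; first exact: env_class_open.
  by exists (h, x).
move=> [a _] /= [Aa [[b y] B'b <-]] /=; apply: VU => /=; rewrite env_actE.
by apply: (AB (a, (b, y))); split=> //; exact: B'B.
Qed.

Fact env_continuous_pa : continuous_pa env_partialAction.
Proof. by apply: continuous_subspaceT; exact: env_act_continuous. Qed.

Fact env_topological_pa : topological_pa env_partialAction.
Proof.
have cg g : continuous (env_act g).
  move=> q; apply: (@continuous_comp _ _ _ (fun p : enveloping => (g, p))
    (fun p : G * enveloping => env_act p.1 p.2)); last exact: env_act_continuous.
  apply: (@cvg_pair _ _ _ (nbhs q) (nbhs g) (nbhs q)); [exact: cvg_cst|exact: cvg_id].
have K g : cancel (env_act g) (env_act g^-1).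
  by move=> q; have [] := @env_actK g q I.
move=> g; split; first exact: openT.
split.
- split=> //; first by move=> a b _ _; exact: (can_inj (K g)).
  move=> q _; exists (env_act g^-1 q) => //.
  by have := K g^-1 q; rewrite invgK.
- exact: continuous_subspaceT.
- exists (env_act g^-1); first by move=> q _; exact: K.
  exact: continuous_subspaceT.
Qed.

Definition enveloping_gspace : gspace G :=
  GSpace env_topological_pa env_continuous_pa.

End enveloping.

Section unit_interval.
Context (R : realType).

Definition unit_itv : Type := set_type (`[0%R : R, 1%R] : set R).
HB.instance Definition _ :=
  Topological.copy unit_itv (set_type (`[0%R : R, 1%R] : set R)).

Fact itv0_subproof : (0%R : R) \in (`[0%R : R, 1%R] : set R).
Proof. by rewrite inE /= in_itv /= lexx ler01. Qed.
Fact itv1_subproof : (1%R : R) \in (`[0%R : R, 1%R] : set R).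
Proof. by rewrite inE /= in_itv /= lexx ler01. Qed.
Definition itv0 : unit_itv := exist _ 0%R itv0_subproof.
Definition itv1 : unit_itv := exist _ 1%R itv1_subproof.

End unit_interval.

Section contractibility.
Context (R : realType) {G : topologicalGroupType} (X : gspace G).
Local Notation th := (gs_act X).
Local Notation unit_itv := (unit_itv R).

Let cyl_dom : set (G * (X * unit_itv)) := [set p | pa_dom th (p.1, p.2.1)].
Let cyl_act (g : G) (p : X * unit_itv) := (pa_act th g p.1, p.2).

Fact cyl_actK g p : cyl_dom (g, p) ->
  cyl_dom (g^-1, cyl_act g p) /\ cyl_act g^-1 (cyl_act g p) = p.
Proof.
case: p => x t d; have [? e] := partial_actK (d : pa_dom th (g, x)).
by rewrite /cyl_act /= e.
Qed.

Fact cyl_actM g h p : cyl_dom (h, p) -> cyl_dom (g, cyl_act h p) ->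
  cyl_dom (g * h, p) /\ cyl_act g (cyl_act h p) = cyl_act (g * h) p.
Proof.
case: p => x t d d'.
have [? e] := partial_actM (d : pa_dom th (h, x)) (d' : pa_dom th (g, _)).
by rewrite /cyl_act /= e.
Qed.

Fact cyl_act1 p : cyl_dom (1, p) /\ cyl_act 1 p = p.
Proof. by case: p => x t; have [? e] := partial_act1 th x; rewrite /cyl_act /= e. Qed.

Definition cyl_partialAction : partialAction G (X * unit_itv)%type :=
  PartialAction cyl_actK cyl_actM cyl_act1.

Fact cyl_continuous_pa : continuous_pa cyl_partialAction.
Proof.
apply/subspace_continuousP => -[g [x t]] /= d.
have /subspace_continuousP/(_ (g, x) d) c := @gs_continuous G X.
apply: (@cvg_pair _ _ _ _ (nbhs (pa_act th g x)) (nbhs t)) => /=; last first.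
  apply: cvg_within_filter.
  by apply: (@cvg_comp _ _ _ snd snd _ (nbhs (x, t))); [exact: cvg_snd|exact: cvg_snd].
have c' : (fun p : G * (X * unit_itv) => (p.1, p.2.1)) @ (g, (x, t)) --> (g, x).
  apply: cvg_pair => /=; first exact: cvg_fst.
  by apply: (@cvg_comp _ _ _ snd fst _ (nbhs (x, t))); [exact: cvg_snd|exact: cvg_fst].
apply: (@cvg_comp _ _ _ (fun p : G * (X * unit_itv) => (p.1, p.2.1))
  (fun p => pa_act th p.1 p.2) _ (within (pa_dom th) (nbhs (g, x)))); last exact: c.
by move=> U /= nU; exact: c' nU.
Qed.

Fact cyl_topological_pa : topological_pa cyl_partialAction.
Proof.
move=> g; split.
  rewrite openE => -[x t] d; have [+ _] := gs_act_near d.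
  by move=> n; exact: cvg_fst n.
have [og [bg cg [f' K cf']]] := gs_topological X g.
have W A (f : X -> X) : {within A, continuous f} ->
  {within [set p : X * unit_itv | A p.1], continuous (fun p => (f p.1, p.2))}.
  move=> /subspace_continuousP c; apply/subspace_continuousP => -[x t] /= Ax.
  apply: (@cvg_pair _ _ _ _ (nbhs (f x)) (nbhs t)) => /=; last first.
    by apply: cvg_within_filter; exact: cvg_snd.
  apply: (@cvg_comp _ _ _ fst f _ (within A (nbhs x))); last exact: c.
  by move=> U /= nU; exact: (@cvg_fst _ _ (nbhs x) (nbhs t) _ _ nU).
split.
- have [h1 h2 h3] := bg; split.
  + by move=> [x t] /= /h1.
  + move=> [x t] [y s]; rewrite !inE => /= dx dy [e ->]; congr (_, _).
    by apply: h2 => //; rewrite inE.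
  + by move=> [x t] /= /h3[y dy e]; exists (y, t) => //; rewrite /cyl_act /= e.
- exact: W cg.
- exists (fun p => (f' p.1, p.2)); last exact: W cf'.
  by move=> [x t]; rewrite inE /cyl_act => /= d; rewrite K // inE.
Qed.

(* [X * I] with the diagonal partial action, [I] carrying the trivial action. *)
Definition cylinder : gspace G := GSpace cyl_topological_pa cyl_continuous_pa.

Definition gcontractible :=
  exists2 w : X, fixed_point th w &
  exists H : cylinder -> X,
    [/\ gmap H, forall x, H (x, itv1 R) = x & forall x, H (x, itv0 R) = w].

End contractibility.

(* Main.v *)
Require Import Defs.
From mathcomp Require Import all_boot all_order all_algebra.
From mathcomp Require Import all_classical all_reals all_analysis.

(** A contraction [H] of [X] to [w] induces [([g, x], t) |-> [g, H (x, t)]] on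
    [X_G]. It is well defined because [H] is a G-map, continuous because the
    projection from [G * X] onto [X_G] is open (so its product with the interval
    is again a quotient map), and it contracts [X_G] to the class of [(1, w)],
    which is also the class of every [(g, w)] because [w] is fixed. *)

Set Implicit Arguments.
Unset Strict Implicit.
Unset Printing Implicit Defensive.

Local Open Scope classical_set_scope.
Local Open Scope group_scope.

Section enveloping_homotopy.
Context (R : realType) (G : topologicalGroupType) (X : gspace G)
  (H : cylinder R X -> X).

(** The value is computed on a chosen representative; [env_homotopyE] shows that the choice is
    immaterial. *)
Definition env_homotopy (p : cylinder R (enveloping_gspace X)) :
    enveloping_gspace X :=
  env_class (repr p.1).1 (H ((repr p.1).2, p.2)).

Context (gmapH : gmap H).

Lemma env_homotopyE g x t :
  env_homotopy (env_class g x, t) = env_class g (H (x, t)).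
Proof.
rewrite /env_homotopy /=; set p := repr _.
have /env_classE : env_class p.1 p.2 = env_class g x.
  by rewrite /env_class -surjective_pairing /p reprK.
rewrite /env_relP /pa_set /= invgM invgK => -[d e]; apply/env_classE.
rewrite /env_relP /pa_set /= invgM invgK.
(* The element [g^-1 * p.1] carries [p.2] to [x]; equivariance of [H] makes it carry [H (p.2, t)] to
   [H (x, t)]. *)
by have [? ->] := gmapH.2 (g^-1 * p.1) (p.2, t) d; split=> //=; rewrite e.
Qed.

Lemma env_homotopy_continuous : continuous env_homotopy.
Proof.
move=> [q t]; elim/(@env_classP G X): q => g x U /=.
rewrite env_homotopyE => nU.
have c : (fun p : (G * X) * unit_itv R => env_class p.1.1 (H (p.1.2, p.2)))
    @ ((g, x), t) --> env_class g (H (x, t)).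
  apply: (@cvg_comp _ _ _ (fun p : (G * X) * unit_itv R =>
    (p.1.1, H (p.1.2, p.2))) (fun p : G * X => env_class p.1 p.2)
    _ (nbhs (g, H (x, t))));
    last exact: (@env_class_continuous G X (g, H (x, t))).
  apply: cvg_pair => /=.
    by apply: (@cvg_comp _ _ _ fst fst _ (nbhs (g, x))); exact: cvg_fst.
  apply: (@cvg_comp _ _ _ (fun p : (G * X) * unit_itv R => (p.1.2, p.2))
    H _ (nbhs (x, t))); last exact: (gmapH.1 (x, t)).
  apply: (@cvg_pair _ _ _ _ (nbhs x) (nbhs t)) => /=; last exact: cvg_snd.
  by apply: (@cvg_comp _ _ _ fst snd _ (nbhs (g, x)));
    [exact: cvg_fst|exact: cvg_snd].
have [[A B] /= [nA nB] AB] := c _ nU.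
move: nA; rewrite nbhsE => -[A' [oA' A'gx] A'A].
(* The image of [A'] is open, and each of its points has a representative in [A'], where the
   continuity [c] of the lifted map applies. *)
exists ([set env_class p.1 p.2 | p in A'], B) => /=.
  split=> //; apply: open_nbhs_nbhs; split; first exact: env_class_open.
  by exists (g, x).
move=> [_ s] /= [[[h y] A'hy <-]] Bs /=; rewrite env_homotopyE.
by apply: (AB ((h, y), s)); split=> //; exact: A'A.
Qed.

(** The enveloping action is global and multiplies only the [G]-coordinate, while the homotopy moves
    only the [X]-coordinate, so they commute. *)
Lemma env_homotopy_gmap : gmap env_homotopy.
Proof.
split; first exact: env_homotopy_continuous.
move=> g [q t] _; split=> //=; elim/(@env_classP G X): q => h x.
by rewrite /= env_actE !env_homotopyE env_actE.
Qed.

End enveloping_homotopy.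

Lemma env_class_fixed (G : topologicalGroupType) (X : gspace G) (w : X) :
  fixed_point (gs_act X) w -> forall g, env_class g w = env_class 1 w.
Proof.
move=> fw g; apply/env_classE; rewrite /env_relP /pa_set /= invgM invgK.
(* The relation between [(g, w)] and [(1, w)] says exactly that [1^-1 * g] is in the isotropy group
   of [w]. *)
by have : isotropy (gs_act X) w (1^-1 * g) by rewrite fw.
Qed.

Theorem theorem4p6 (R : realType) (G : topologicalGroupType)
  (hG : hausdorff_space G) (X : gspace G) :
  gcontractible R X -> gcontractible R (enveloping_gspace X).
Proof.
move=> [w fw [H [gmapH H1 H0]]]; exists (env_class 1 w).
  rewrite /fixed_point; apply/seteqP; split=> // g _; split=> //=.
  by rewrite env_actE; exact: env_class_fixed.
exists (env_homotopy H); split; first exact: env_homotopy_gmap.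
- by elim/(@env_classP G X) => g x; rewrite env_homotopyE // H1.
- by elim/(@env_classP G X) => g x; rewrite env_homotopyE // H0 env_class_fixed.
Qed.
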